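(* Let $B$ be a nonzero semiprimitive commutative ring with unity. Then $B$ is an associated semi-transitional ring if and only if for all $a,b\in B$ there exists $c$ in the ideal $(a,b)$ such that $\mathscr{M}(a)\cap\mathscr{M}(b)=\mathscr{M}(c)$, where $\mathscr{M}(x)=\{M\in\mathrm{Max}(B)\mid x\in M\}$ for $x\in B$.
   Context: All rings are commutative with unity. $\mathrm{Max}(B)$ is the set of maximal ideals of $B$; $B$ is semiprimitive if its Jacobson radical is $0$. $\mathcal{P}(\Lambda)$ is the power set of $\Lambda$. For a ring $A$ and a nonempty set $\Lambda$, a map $\psi:A\to\mathcal{P}(\Lambda)$ is a semi-transition map on $A$ if: (i) $\psi(ab)=\psi(a)\cup\psi(b)$ for all $a,b\in A$; (ii) $\psi(1)=\emptyset$, and $\psi(a)=\Lambda$ if and only if $a=0$; (iii) for all $a,b\in A$ there is some $c$ in the ideal $(a,b)$ with $\psi(a)\cap\psi(b)=\psi(c)\subseteq\psi(a+b)$; moreover, if $\psi(a)\cap\psi(b)=\emptyset$, then the ideal $(a^m,b^n)$ is principal for some $m,n\in\mathbb{N}$ (positive integers). A ring is semi-transitional if it admits a semi-transition map into $\mathcal{P}(\Lambda)$ for some nonempty $\Lambda$. For a semi-transitional ring $D$ with semi-transition map $\psi$, put $S=\{d\in D\mid\psi(d)=\emptyset\}$ (a multiplicatively closed set); the localization $D_S=S^{-1}D$ is called the associated semi-transitional ring attached to $D$. A ring $B$ is an associated semi-transitional ring if $B\cong D_S$ for some semi-transitional ring $D$ with semi-transition map $\psi$ and $S=\{d\in D\mid\psi(d)=\emptyset\}$.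 *)

(* Defs.v *)
From HB Require Import structures.
From mathcomp Require Import all_boot all_algebra ring.
From mathcomp Require Import boolp classical_sets.

Set Implicit Arguments.
Unset Strict Implicit.
Unset Printing Implicit Defensive.

Import GRing.Theory.
Local Open Scope ring_scope.
Local Open Scope classical_set_scope.

Section GeneratedIdeals.
Variable R : comPzRingType.

Definition ideal1 (a : R) : set R := [set x | exists r : R, x = r * a].

Definition ideal2 (a b : R) : set R :=
  [set x | exists r s : R, x = r * a + s * b].

Definition principal_ideal (I : set R) : Prop := exists d : R, I = ideal1 d.

End GeneratedIdeals.

Section MaximalIdeals.
Variable B : comNzRingType.

(* [idealr_closed] already requires that 1 is not in the ideal. *)
Definition maximal_ideal (M : set B) : Prop :=
  idealr_closed (mem M) /\
  forall I : set B, idealr_closed (mem I) -> M `<=` I -> I = M.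

Definition Max : set (set B) := [set M | maximal_ideal M].

Definition jacobson_radical : set B := \bigcap_(M in Max) M.

Definition semiprimitive : Prop := jacobson_radical = [set 0].

Definition Max_containing (x : B) : set (set B) := [set M | Max M /\ M x].

End MaximalIdeals.

Arguments Max B : clear implicits.
Arguments jacobson_radical B : clear implicits.
Arguments semiprimitive B : clear implicits.

(* The ring of fractions of a commutative ring D at a multiplicatively closed  *)
(* set S. As S may contain zero divisors, fractions are identified by          *)
(*   a/s = b/t  <->  u * (a * t) = u * (b * s) for some u in S.                *)
Module Localization.
Section Localization.
Local Open Scope quotient_scope.

Variables (D : comPzRingType) (S : mulrClosed D).

Record denom := Denom { denom_val : D; denomP : denom_val \in S }.
#[export]
HB.instance Definition _ := [isSub for denom_val].
#[export]
HB.instance Definition _ := [Choice of denom by <:].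

Local Notation dom := (D * denom)%type.
Implicit Types (x y z : dom) (s t : denom).

Definition denom1 := Denom (rpred1 S).
Definition denomM s t := Denom (rpredM (denomP s) (denomP t)).

Definition equivl x y : bool :=
  `[< exists2 u, u \in S & u * (x.1 * denom_val y.2) = u * (y.1 * denom_val x.2) >].

Lemma equivl_refl : reflexive equivl.
Proof. by move=> x; apply/asboolP; exists 1; rewrite ?rpred1. Qed.

Lemma equivl_sym : symmetric equivl.
Proof. by move=> x y; apply/asboolP/asboolP => -[u uS e]; exists u. Qed.

Lemma equivl_trans : transitive equivl.
Proof.
move=> [b [t tS]] [a [s sS]] [c [r rS]] /asboolP[u uS /= e1].
move=> /asboolP[v vS /= e2].
apply/asboolP; exists (u * v * t); rewrite ?rpredM //=.
have -> : u * v * t * (a * r) = v * r * (u * (a * t)) by ring.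
have -> : u * v * t * (c * s) = u * s * (v * (c * t)) by ring.
by rewrite e1 -e2; ring.
Qed.

Canonical equivl_equiv :=
  EquivRel equivl equivl_refl equivl_sym equivl_trans.

Definition type := {eq_quot equivl}.
#[export]
HB.instance Definition _ : EqQuotient _ equivl type := EqQuotient.on type.
#[export]
HB.instance Definition _ := Choice.on type.

Definition frac (a : D) (s : denom) : type := \pi_type (a, s).

Lemma frac_eqP (a b : D) s t :
  frac a s = frac b t <->
  exists2 u, u \in S & u * (a * denom_val t) = u * (b * denom_val s).
Proof.
rewrite /frac; split; first by move/eqmodP/asboolP.
by move=> ?; apply/eqmodP/asboolP.
Qed.

Lemma fracW (P : type -> Prop) : (forall a s, P (frac a s)) -> forall q, P q.
Proof. by move=> Pfrac; elim/quotW => -[a s]; apply: Pfrac. Qed.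

Definition add (p q : type) : type :=
  let: (a, s) := repr p in let: (b, t) := repr q in
  frac (a * denom_val t + b * denom_val s) (denomM s t).

Definition opp (p : type) : type := let: (a, s) := repr p in frac (- a) s.

Definition mul (p q : type) : type :=
  let: (a, s) := repr p in let: (b, t) := repr q in
  frac (a * b) (denomM s t).

Lemma reprP (a : D) s : exists b t,
  repr (frac a s) = (b, t) /\
  exists2 u, u \in S & u * (b * denom_val s) = u * (a * denom_val t).
Proof.
case e: (repr (frac a s)) => [b t]; exists b, t; split=> //.
by apply/frac_eqP; rewrite -[RHS]reprK e.
Qed.

Lemma addE (a b : D) s t :
  add (frac a s) (frac b t) = frac (a * denom_val t + b * denom_val s) (denomM s t).
Proof.
rewrite /add; have [a' [s' [-> [u uS eu]]]] := reprP a s.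
have [b' [t' [-> [v vS ev]]]] := reprP b t.
apply/frac_eqP; exists (u * v); rewrite ?rpredM //=.
transitivity (v * (denom_val t * denom_val t') * (u * (a' * denom_val s)) +
  u * (denom_val s * denom_val s') * (v * (b' * denom_val t))); first by ring.
by rewrite eu ev; ring.
Qed.

Lemma oppE (a : D) s : opp (frac a s) = frac (- a) s.
Proof.
rewrite /opp; have [a' [s' [-> [u uS eu]]]] := reprP a s.
by apply/frac_eqP; exists u; rewrite ?mulNr ?mulrN ?eu.
Qed.

Lemma mulE (a b : D) s t :
  mul (frac a s) (frac b t) = frac (a * b) (denomM s t).
Proof.
rewrite /mul; have [a' [s' [-> [u uS eu]]]] := reprP a s.
have [b' [t' [-> [v vS ev]]]] := reprP b t.
apply/frac_eqP; exists (u * v); rewrite ?rpredM //=.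
transitivity (u * (a' * denom_val s) * (v * (b' * denom_val t))); first by ring.
by rewrite eu ev; ring.
Qed.

Lemma addA : associative add.
Proof.
elim/fracW=> a s; elim/fracW=> b t; elim/fracW=> c r; rewrite !addE.
by apply/frac_eqP; exists 1; rewrite ?rpred1 //=; ring.
Qed.

Lemma addC : commutative add.
Proof.
elim/fracW=> a s; elim/fracW=> b t; rewrite !addE.
by apply/frac_eqP; exists 1; rewrite ?rpred1 //=; ring.
Qed.

Lemma add0l : left_id (frac 0 denom1) add.
Proof.
elim/fracW=> a s; rewrite addE.
by apply/frac_eqP; exists 1; rewrite ?rpred1 //=; ring.
Qed.

Lemma addNl : left_inverse (frac 0 denom1) opp add.
Proof.
elim/fracW=> a s; rewrite oppE addE.
by apply/frac_eqP; exists 1; rewrite ?rpred1 //=; ring.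
Qed.

#[export]
HB.instance Definition _ := GRing.isZmodule.Build type addA addC add0l addNl.

Lemma mulA : associative mul.
Proof.
elim/fracW=> a s; elim/fracW=> b t; elim/fracW=> c r; rewrite !mulE.
by apply/frac_eqP; exists 1; rewrite ?rpred1 //=; ring.
Qed.

Lemma mulC : commutative mul.
Proof.
elim/fracW=> a s; elim/fracW=> b t; rewrite !mulE.
by apply/frac_eqP; exists 1; rewrite ?rpred1 //=; ring.
Qed.

Lemma mul1l : left_id (frac 1 denom1) mul.
Proof.
elim/fracW=> a s; rewrite mulE.
by apply/frac_eqP; exists 1; rewrite ?rpred1 //=; ring.
Qed.

Lemma mulDl : left_distributive mul add.
Proof.
elim/fracW=> a s; elim/fracW=> b t; elim/fracW=> c r.
rewrite addE !mulE addE.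
by apply/frac_eqP; exists 1; rewrite ?rpred1 //=; ring.
Qed.

#[export]
HB.instance Definition _ :=
  GRing.Zmodule_isComPzRing.Build type mulA mulC mul1l mulDl.

End Localization.
Module Exports. HB.reexport. End Exports.
End Localization.
Export Localization.Exports.

Notation localization := Localization.type.
Arguments Localization.type {D} S.

Section SemiTransition.
Variables (D : comPzRingType) (L : Type).

Definition is_semi_transition_map (psi : D -> set L) : Prop :=
  [/\ forall a b, psi (a * b) = psi a `|` psi b,
      psi 1 = set0 /\ (forall a, psi a = setT <-> a = 0)
    & forall a b,
        (exists2 c, ideal2 a b c &
           psi a `&` psi b = psi c /\ psi c `<=` psi (a + b)) /\
        (psi a `&` psi b = set0 ->
           exists m n : nat, [/\ (0 < m)%N, (0 < n)%N &
             principal_ideal (ideal2 (a ^+ m) (b ^+ n))])].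

Record semi_transition_map := SemiTransitionMap {
  semi_transition_fun :> D -> set L;
  semi_transitionP : is_semi_transition_map semi_transition_fun
}.

Variable psi : semi_transition_map.

Definition null_set : {pred D} := [pred d | `[< psi d = set0 >]].

Lemma null_set_mulr_closed : mulr_closed null_set.
Proof.
have [psiM [psi1 _] _] := semi_transitionP psi.
split=> [|a b]; first exact: (introT (asboolP _) psi1).
move=> /(elimT (asboolP _)) a0 /(elimT (asboolP _)) b0.
by apply: (introT (asboolP _)); rewrite psiM a0 b0 setU0.
Qed.

HB.instance Definition _ :=
  GRing.isMulClosed.Build D null_set null_set_mulr_closed.

Definition associated_ring : comPzRingType := localization null_set.

End SemiTransition.

Definition ring_isomorphic (R R' : pzRingType) : Prop :=
  exists f : {rmorphism R -> R'}, bijective f.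

Definition associated_semi_transitional_ring (B : comPzRingType) : Prop :=
  exists (D : comPzRingType) (L : Type) (psi : semi_transition_map D L),
    [set: L] !=set0 /\ ring_isomorphic B (associated_ring psi).

(* Main.v *)
Require Import Defs.
From HB Require Import structures.
From mathcomp Require Import all_boot all_algebra ring.
From mathcomp Require Import boolp classical_sets.

(** For a semi-transition map psi on D and a maximal ideal M of the ring of
    fractions, psi c `<=` psi a and c in M force a in M: otherwise
    r a + e is a denominator for some e in M, so psi a `&` psi e is empty, hence
    so is psi c `&` psi e, and the ideal (c, e), contained in M, has an element
    with empty psi, that is a unit.  The condition on the sets of maximal ideals
    is thus inherited from psi.  Conversely, under that condition
    x |-> Max_containing x is itself a semi-transition map on B; its null set
    consists of the units of B, so B is its own ring of fractions. *)

Set Implicit Arguments.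
Unset Strict Implicit.
Unset Printing Implicit Defensive.

Import GRing.Theory.
Local Open Scope ring_scope.
Local Open Scope classical_set_scope.

(** * Maximal ideals of a nonzero commutative ring *)

Section Ideals.
Variable B : comNzRingType.
Implicit Types (I M : set B) (x y : B).

Lemma idealr_closedP I : idealr_closed (mem I) <->
  [/\ I 0, ~ I 1 & forall a u v, I u -> I v -> I (a * u + v)].
Proof.
split=> [[I0 I1 Il]|[I0 I1 Il]]; split.
- exact/set_mem.
- by move=> I1'; case/negP: I1; apply/mem_set.
- by move=> a u v Iu Iv; apply/set_mem/Il; apply/mem_set.
- exact/mem_set.
- by apply/negP => /set_mem.
- by move=> a u v /set_mem Iu /set_mem Iv; apply/mem_set/Il.
Qed.

Lemma maximal_ideal_ideal2 M u v w :
  maximal_ideal M -> M u -> M v -> ideal2 u v w -> M w.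
Proof.
move=> [/idealr_closedP[M0 _ Ml] _] Mu Mv [r [s ->]].
by apply: (Ml) => //; rewrite -[_ * _]addr0; apply: Ml.
Qed.

Lemma maximal_ideal_mull M u r : maximal_ideal M -> M u -> M (r * u).
Proof.
by move=> maxM Mu; apply: (maximal_ideal_ideal2 maxM Mu Mu); exists r, 0; ring.
Qed.

Lemma maximal_ideal_proper M : maximal_ideal M -> ~ M 1.
Proof. by case=> /idealr_closedP[]. Qed.

Lemma maximal_ideal_compl M x : maximal_ideal M -> ~ M x ->
  exists r, exists2 m, M m & r * x + m = 1.
Proof.
move=> [/idealr_closedP[M0 M1 Ml] maxM] Mx; apply: contrapT => no1.
(* [J] is the ideal generated by [M] and [x]. If it misses 1, maximality gives [J = M], which puts
   [x] in [M]. *)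
pose J := [set y | exists r, exists2 m, M m & y = r * x + m].
have J_ideal : idealr_closed (mem J).
  apply/idealr_closedP; split.
  - by exists 0, 0; rewrite ?mul0r ?addr0.
  - by move=> [r [m Mm e]]; apply: no1; exists r, m.
  - move=> a _ _ [r [m Mm ->]] [s [n Mn ->]].
    by exists (a * r + s), (a * m + n); [apply: Ml|ring].
have JM : J = M.
  by apply: maxM => // m Mm; exists 0, m; rewrite // mul0r add0r.
by apply: Mx; rewrite -JM; exists 1, 0; rewrite ?mul1r ?addr0.
Qed.

Lemma maximal_ideal_mulP M x y : maximal_ideal M -> M (x * y) <-> M x \/ M y.
Proof.
move=> maxM; split=> [Mxy|[Mx|My]]; last 2 first.
- by rewrite mulrC; apply: maximal_ideal_mull.
- exact: maximal_ideal_mull.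
have [Mx|Mx] := pselect (M x); [by left|right].
have [r [m Mm e]] := maximal_ideal_compl maxM Mx.
apply: (maximal_ideal_ideal2 maxM Mxy Mm).
by exists r, y; rewrite -[LHS]mulr1 -e; ring.
Qed.

Lemma exists_maximal_ideal I : idealr_closed (mem I) ->
  exists2 M, maximal_ideal M & I `<=` M.
Proof.
move=> I_ideal.
(* The empty set is admitted so that the empty chain has a union satisfying P. *)
pose P J := J = set0 \/ idealr_closed (mem J) /\ I `<=` J.
have [F FP Ftot|M [PM maxM]] := @Zorn_bigcup _ P.
  have [[J0 [FJ0 [J0_ideal IJ0]]]|noJ] :=
      pselect (exists J, F J /\ idealr_closed (mem J) /\ I `<=` J); last first.
    left; rewrite -subset0 => x [J FJ Jx].
    have [J0|J_ideal] := FP _ FJ; first by rewrite J0 in Jx.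
    by apply: noJ; exists J.
  right; split; last by move=> x /IJ0 J0x; exists J0.
  have ideal_of J x : F J -> J x -> idealr_closed (mem J).
    by move=> FJ Jx; have [J_0|[]] := FP _ FJ; first by rewrite J_0 in Jx.
  have /idealr_closedP[J00 _ _] := J0_ideal.
  apply/idealr_closedP; split; first by exists J0.
    by move=> [J FJ J1]; have /idealr_closedP[] := ideal_of _ _ FJ J1.
  move=> a u v [J FJ Ju] [K FK Kv].
  have [JK|KJ] := Ftot _ _ FJ FK.
    exists K => //; have /idealr_closedP[_ _] := ideal_of _ _ FK Kv.
    by apply=> //; apply: JK.
  exists J => //; have /idealr_closedP[_ _] := ideal_of _ _ FJ Ju.
  by apply=> //; apply: KJ.
have Inonempty : I 0 by have /idealr_closedP[] := I_ideal.
(* The maximal element is not the empty set: [I] satisfies [P] and contains 0, so it would be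
   strictly larger. *)
have [M0|[M_ideal IM]] := PM.
  have /maxM[] : M `<` I by rewrite M0; split=> [//|/(_ _ Inonempty)].
  by right; split.
exists M => //; split=> // J J_ideal MJ; apply: contrapT => JM.
have /maxM[] : M `<` J by split=> // JsubM; apply: JM; apply/seteqP.
by right; split=> //; apply: subset_trans MJ.
Qed.

(** A non-unit generates a proper ideal, and this lies in some maximal ideal. *)
Lemma Max_containing_eq0 x : Max_containing x = set0 <-> exists y, y * x = 1.
Proof.
split=> [Mx0|[y yx]]; last first.
  rewrite -subset0 => M [maxM Mx]; apply: (maximal_ideal_proper maxM).
  by rewrite -yx; apply: maximal_ideal_mull.
apply: contrapT => nounit.
have : idealr_closed (mem (ideal1 x)).
  apply/idealr_closedP; split; first by exists 0; rewrite mul0r.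
    by move=> [y yx]; apply: nounit; exists y.
  by move=> a _ _ [r ->] [s ->]; exists (a * r + s); ring.
move=> /exists_maximal_ideal[M maxM xM].
suff : Max_containing x M by rewrite Mx0.
by split=> //; apply: xM; exists 1; rewrite mul1r.
Qed.

Lemma Max_nonempty : exists M, maximal_ideal M.
Proof.
suff [M] : Max_containing (0 : B) !=set0 by case; exists M.
apply/set0P/eqP => /Max_containing_eq0[y].
by rewrite mulr0 => /eqP; rewrite eq_sym oner_eq0.
Qed.

End Ideals.

(** * The canonical map into a ring of fractions *)

Section LocalizationMap.
Variables (D : comPzRingType) (S : mulrClosed D).

Definition tofrac (d : D) : localization S :=
  Localization.frac d (Localization.denom1 S).

Lemma tofrac_is_zmod_morphism : zmod_morphism tofrac.
Proof.
move=> a b; rewrite /tofrac.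
(* Subtraction in the quotient ring unfolds to [add] and [opp], whose values on fractions are
   known. *)
rewrite [RHS](_ : _ = Localization.add (Localization.frac a (Localization.denom1 S))
   (Localization.opp (Localization.frac b (Localization.denom1 S)))) //.
rewrite Localization.oppE Localization.addE.
by apply/Localization.frac_eqP; exists 1; rewrite ?rpred1 //=; ring.
Qed.

Lemma tofrac_is_monoid_morphism : GRing.monoid_morphism tofrac.
Proof.
split=> // a b; rewrite [RHS]Localization.mulE.
by apply/Localization.frac_eqP; exists 1; rewrite ?rpred1 //=; ring.
Qed.

HB.instance Definition _ :=
  GRing.isZmodMorphism.Build D (localization S) tofrac tofrac_is_zmod_morphism.
HB.instance Definition _ :=
  GRing.isMonoidMorphism.Build D (localization S) tofrac
    tofrac_is_monoid_morphism.

Lemma tofrac_eq a b :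
  tofrac a = tofrac b <-> exists2 u, u \in S & u * a = u * b.
Proof.
split=> [/Localization.frac_eqP|] [u uS e].
  by exists u => //; move: e; rewrite /= !mulr1.
by apply/Localization.frac_eqP; exists u; rewrite //= !mulr1.
Qed.

Lemma tofrac_unit s : s \in S -> exists q, q * tofrac s = 1.
Proof.
move=> sS; exists (Localization.frac 1 (Localization.Denom sS)).
rewrite [LHS]Localization.mulE.
by apply/Localization.frac_eqP; exists 1; rewrite ?rpred1 //=; ring.
Qed.

Lemma tofrac_surj (q : localization S) :
  exists a s, s \in S /\ tofrac s * q = tofrac a.
Proof.
elim/Localization.fracW: q => a s.
exists a, (Localization.denom_val s); split; first exact: Localization.denomP.
rewrite [LHS]Localization.mulE.
by apply/Localization.frac_eqP; exists 1; rewrite ?rpred1 //=; ring.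
Qed.

End LocalizationMap.

Lemma ring_isomorphic_sym (R R' : pzRingType) :
  ring_isomorphic R R' -> ring_isomorphic R' R.
Proof.
move=> [f [g fK gK]].
pose gZ := GRing.isZmodMorphism.Build _ _ g (can2_zmod_morphism fK gK).
pose gM := GRing.isMonoidMorphism.Build _ _ g (can2_monoid_morphism fK gK).
pose g' : {rmorphism R' -> R} := HB.pack g gZ gM.
by exists g'; exists f.
Qed.

Lemma null_setP (D : comPzRingType) (L : Type) (psi : semi_transition_map D L) d :
  d \in null_set psi <-> psi d = set0.
Proof. by split=> [/asboolP|?]; last apply/asboolP. Qed.

(** * From a semi-transition map to sets of maximal ideals *)

Section FractionsOfSemiTransitional.
Variables (D : comPzRingType) (L : Type) (psi : semi_transition_map D L).
Variables (B : comNzRingType) (phi : {rmorphism D -> B}).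
(** The three hypotheses say that [phi] makes [B] a ring of fractions of [D] at the null set of
    [psi], up to isomorphism. The argument thus avoids both the quotient construction and the given
    isomorphism. *)
Hypothesis phi_unit : forall s, psi s = set0 -> exists y, y * phi s = 1.
Hypothesis phi_surj :
  forall x, exists a s, psi s = set0 /\ phi s * x = phi a.
Hypothesis phi_eq : forall a b, phi a = phi b ->
  exists2 u, psi u = set0 & u * a = u * b.

Lemma maximal_ideal_semi_transition (M : set B) a c :
  maximal_ideal M -> psi c `<=` psi a -> M (phi c) -> M (phi a).
Proof.
move=> maxM ca Mc; apply: contrapT => Ma.
have [psiM _ psiI] := semi_transitionP psi.
have [r [m Mm em]] := maximal_ideal_compl maxM Ma.
have [d [s [s0 ed]]] := phi_surj r; have [e [t [t0 ee]]] := phi_surj m.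
(* This is [r * phi a + m = 1] multiplied by [phi (s * t)]; the factor [u] is the price of lifting
   the equation to [D]. *)
have /phi_eq[u u0 eu] : phi (t * d * a + s * e) = phi (s * t).
  rewrite rmorphD !rmorphM -ed -ee -[RHS]mulr1 -em; ring.
have ust0 : psi (u * (s * t)) = set0 by rewrite !psiM u0 s0 t0 !setU0.
(* The two summands add up to [u * (s * t)], where [psi] is empty, so axiom (iii) makes their values
   of [psi] disjoint. *)
have [[_ _ [<- +]] _] := psiI (u * (t * d * a)) (u * (s * e)).
rewrite -mulrDr eu ust0 subset0 => disj.
have psi_e : psi (u * (s * e)) = psi e by rewrite !psiM u0 s0 !set0U.
(* [psi w] is the intersection of [psi c] and [psi e]. It is empty since [psi c] lies in [psi a],
   hence in [psi (u * (t * d * a))]. *)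
have [[w we [ew _]] _] := psiI c e.
have w0 : psi w = set0.
  rewrite -ew -subset0 -disj psi_e => l [/ca al el]; split=> //.
  by rewrite !psiM; right; right.
have Me : M (phi e) by rewrite -ee; apply: maximal_ideal_mull.
have Mw : M (phi w).
  apply: (maximal_ideal_ideal2 maxM Mc Me).
  by have [p [q ->]] := we; exists (phi p), (phi q); rewrite rmorphD !rmorphM.
have [y yw] := phi_unit w0.
by apply: (maximal_ideal_proper maxM); rewrite -yw; apply: maximal_ideal_mull.
Qed.

(** Up to units, [x] and [y] are images of [a] and [b] in [D]; the image of the element that axiom
    (iii) provides for [a] and [b] serves as [z]. *)
Lemma Max_containingI_fractions (x y : B) : exists2 z, ideal2 x y z &
  Max_containing x `&` Max_containing y = Max_containing z.
Proof.
have [_ _ psiI] := semi_transitionP psi.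
have [a [s [s0 ea]]] := phi_surj x; have [b [t [t0 eb]]] := phi_surj y.
have [[c [p [q ec]] [psi_c _]] _] := psiI a b.
have zxy : ideal2 x y (phi c).
  exists (phi p * phi s), (phi q * phi t).
  by rewrite ec rmorphD !rmorphM -ea -eb; ring.
exists (phi c) => //; apply/seteqP; split=> M.
  by move=> [[maxM Mx] [_ My]]; split=> //; apply: maximal_ideal_ideal2 zxy.
move=> [maxM Mc].
have cancel_denom r z : psi r = set0 -> M (phi r * z) -> M z.
  move=> /phi_unit[i ir] Mz; rewrite -[z]mul1r -ir -mulrA.
  exact: maximal_ideal_mull.
split; split=> //.
  apply: (cancel_denom _ _ s0); rewrite ea.
  by apply: maximal_ideal_semi_transition Mc => //; rewrite -psi_c => l [].
apply: (cancel_denom _ _ t0); rewrite eb.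
by apply: maximal_ideal_semi_transition Mc => //; rewrite -psi_c => l [].
Qed.

End FractionsOfSemiTransitional.

Lemma associated_semi_transitional_ring_Max (B : comNzRingType) :
  associated_semi_transitional_ring B ->
  forall a b : B, exists2 c : B, ideal2 a b c &
    Max_containing a `&` Max_containing b = Max_containing c.
Proof.
move=> [D [L [psi [_ /ring_isomorphic_sym[g g_bij]]]]].
have [f gK fK] := g_bij.
pose phi : {rmorphism D -> B} := g \o @tofrac D (null_set psi).
apply: (@Max_containingI_fractions _ _ psi _ phi).
- move=> s /null_setP/tofrac_unit[q qs].
  by exists (g q); rewrite -rmorphM qs rmorph1.
- move=> x; have [a [s [/null_setP s0 e]]] := tofrac_surj (f x).
  by exists a, s; split=> //; rewrite -[x]fK -[LHS](rmorphM g) e.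
- move=> a b /(can_inj gK)/tofrac_eq[u /null_setP u0 e].
  by exists u.
Qed.

(** * From sets of maximal ideals to a semi-transition map *)

Section MaximalSpectrumMap.
Variable B : comNzRingType.
Hypothesis B_semiprimitive : semiprimitive B.
Hypothesis B_Max : forall a b : B, exists2 c : B, ideal2 a b c &
  Max_containing a `&` Max_containing b = Max_containing c.

(** Values are taken in the subtype of maximal ideals, so that the value at 0 is the full set. *)
Definition Max_map (x : B) : set {M | Max B M} := [set M | sval M x].

Lemma Max_map_eq0 x : Max_map x = set0 <-> exists y, y * x = 1.
Proof.
rewrite -Max_containing_eq0; split=> x0; rewrite -subset0.
  by move=> M [maxM Mx]; suff : Max_map x (exist _ M maxM) by rewrite x0.
by move=> [M maxM] Mx; suff : Max_containing x M by rewrite x0.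
Qed.

Lemma Max_map_semi_transition : is_semi_transition_map Max_map.
Proof.
split=> [a b|| a b].
- by apply/seteqP; split=> -[M maxM] /=; rewrite /Max_map /= maximal_ideal_mulP.
- split=> [|a]; first by apply/Max_map_eq0; exists 1; rewrite mulr1.
  split=> [aT|->].
    suff : jacobson_radical B a by rewrite B_semiprimitive.
    by move=> M maxM; suff : Max_map a (exist _ M maxM) by []; rewrite aT.
  by apply/seteqP; split=> // -[M maxM] _ /=; have [/idealr_closedP[]] := maxM.
- have [c cab ec] := B_Max a b.
  have psi_c : Max_map a `&` Max_map b = Max_map c.
    apply/seteqP; split=> -[M maxM] /=.
      by move=> [Ma Mb]; apply: (maximal_ideal_ideal2 maxM Ma Mb).
    move=> Mc; have : Max_containing c M by [].
    by rewrite -ec => -[[_ Ma] [_ Mb]].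
  split.
    exists c => //; split=> //; rewrite -psi_c => -[M maxM] /= [Ma Mb].
    by apply: (maximal_ideal_ideal2 maxM Ma Mb); exists 1, 1; rewrite !mul1r.
  (* If the intersection is empty then [c] is a unit, so [(a, b)] is the whole ring: exponents 1 and
     generator 1 suffice. *)
  rewrite psi_c => /Max_map_eq0[y yc]; exists 1%N, 1%N; split=> //.
  have [r [s e]] := cab; exists 1; rewrite !expr1.
  apply/seteqP; split=> z _; first by exists z; rewrite mulr1.
  by exists (z * y * r), (z * y * s); rewrite -[LHS]mulr1 -yc e; ring.
Qed.

Definition Max_semi_transition := SemiTransitionMap Max_map_semi_transition.

Lemma ring_isomorphic_Max_semi_transition :
  ring_isomorphic B (associated_ring Max_semi_transition).
Proof.
pose f : {rmorphism B -> associated_ring Max_semi_transition} :=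
  @tofrac B (null_set Max_semi_transition).
have f_inj : injective f.
  move=> a b /tofrac_eq[u /null_setP/Max_map_eq0[v vu] e].
  by rewrite -[a]mul1r -[b]mul1r -vu -!mulrA e.
have f_surj q : exists x, f x = q.
  have [a [s [sS e]]] := tofrac_surj q.
  have /null_setP/Max_map_eq0[v vs] := sS.
  (* With [v] the inverse of [s] in [B], the fraction [a / s] is the image of [v * a]. *)
  exists (v * a); rewrite rmorphM -[f a]e mulrA -[X in X * q](rmorphM f) vs.
  by rewrite rmorph1 mul1r.
have [g fgK] := choice f_surj.
by exists f; exists g => // x; apply: f_inj.
Qed.

End MaximalSpectrumMap.

Theorem theorem4p1 (B : comNzRingType) (hB : semiprimitive B) :
  associated_semi_transitional_ring B <->
  forall a b : B, exists2 c : B, ideal2 a b c &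
    Max_containing a `&` Max_containing b = Max_containing c.
Proof.
split; first exact: associated_semi_transitional_ring_Max.
move=> hM; exists B, {M | Max B M}, (Max_semi_transition hB hM); split.
  by have [M maxM] := Max_nonempty B; exists (exist _ M maxM).
exact: ring_isomorphic_Max_semi_transition.
Qed.
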